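(* (Prokhorov's theorem for the space of probability measures on any Hausdorff space.) Let $T$ be a Hausdorff space, and let $\mathfrak{P}(T)$ be the space of all Borel probability measures on $T$, equipped with the $A$-topology. Let $\mathfrak{A} \subseteq \mathfrak{P}(T)$ be such that for any real $\epsilon >0$ there exists a compact set $K_{\epsilon} \subseteq T$ for which $$\mu(K_{\epsilon}) \geq 1 - \epsilon \quad \text{for all } \mu \in \mathfrak{A}.$$ Then the closure of $\mathfrak{A}$ in $\mathfrak{P}(T)$ is compact.
   Context: The $A$-topology on $\mathfrak{P}(T)$ is the coarsest topology for which $\mu\mapsto\int_T f\,d\mu$ is upper semicontinuous for every bounded upper semicontinuous $f\colon T\to\mathbb{R}$; equivalently, it is generated by the subbasis of sets $\{\mu\in\mathfrak{P}(T):\mu(G)>\alpha\}$ with $G\subseteq T$ open and $\alpha\in\mathbb{R}$. It need not be Hausdorff; ''compact'' means every open cover has a finite subcover (no Hausdorff requirement). *)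

(* Defs.v *)
From HB Require Import structures.
From mathcomp Require Import all_boot all_order all_algebra.
From mathcomp Require Import all_classical all_reals all_analysis.

Set Implicit Arguments.
Unset Strict Implicit.
Unset Printing Implicit Defensive.

Import Order.TTheory GRing.Theory Num.Theory.
Import numFieldNormedType.Exports.

Local Open Scope classical_set_scope.
Local Open Scope ring_scope.

(* Real-valued; the library only has [lower_semicontinuous], for functions into
   [\bar R]. *)
Definition upper_semicontinuous (X : topologicalType) (R : realType)
    (f : X -> R) : Prop :=
  forall (x : X) (a : R), f x < a -> \forall y \near x, f y < a.

Notation borel T := (g_sigma_algebraType (@open T)).

(* The alias carries the A-topology.  A measure of the library is a function on
   all of [set T] that is constrained only on measurable sets, so points of this
   type that agree on Borel sets need not be equal; such points are
   topologically indistinguishable. *)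
Definition borel_probability (T : ptopologicalType) (R : realType) : Type :=
  probability (borel T) R.

HB.instance Definition _ (T : ptopologicalType) (R : realType) :=
  Pointed.copy (borel_probability T R) (probability (borel T) R).

Definition borel_probability_measure (T : ptopologicalType) (R : realType)
    (mu : borel_probability T R) : probability (borel T) R := mu.

Coercion borel_probability_measure : borel_probability >-> Probability.type.

Definition integral_of (T : ptopologicalType) (R : realType) (f : T -> R)
    (mu : borel_probability T R) : R :=
  \int[mu]_x f x.

(* The coarsest topology for which every [integral_of f], with [f] bounded upper
   semicontinuous, is upper semicontinuous: it is generated by the preimages of
   the rays []-oo, a[] under these maps. *)
HB.instance Definition _ (T : ptopologicalType) (R : realType) :=
  @isSubBaseTopological.Build (borel_probability T R)
    ((T -> R) * R)%type
    [set fa | bounded_fun fa.1 /\ upper_semicontinuous fa.1]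
    (fun fa => [set mu | integral_of fa.1 mu < fa.2]).

Lemma integral_of_usc (T : ptopologicalType) (R : realType) (f : T -> R) :
  bounded_fun f -> upper_semicontinuous f ->
  upper_semicontinuous (@integral_of T R f).
Proof.
move=> bf uf mu a mua.
exists [set nu | integral_of f nu < a]; split => //.
exists [set [set nu | integral_of f nu < a]]; last by rewrite bigcup_set1.
by move=> _ ->; exact: (@finI_from1 _ _ _ _ (f, a)).
Qed.

(* With [X] ranging over the topologies on [borel_probability T R] and [g] the
   identity, this is the minimality of the A-topology. *)
Lemma A_topology_coarsest (T : ptopologicalType) (R : realType)
    (X : topologicalType) (g : X -> borel_probability T R) :
  (forall f : T -> R, bounded_fun f -> upper_semicontinuous f ->
    upper_semicontinuous (integral_of f \o g)) ->
  continuous g.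
Proof.
move=> gP x W; rewrite /= => -[_ [[B DB <-] [V BV Vgx] BA]].
have [F sF VE] := DB _ BV.
suff: \forall y \near x, V (g y).
  by apply: filterS => y Vgy; apply: BA; exists V.
rewrite -VE in Vgx *.
apply: filter_bigI => -[f a] faF.
have [bf uf] : bounded_fun f /\ upper_semicontinuous f.
  by have := sF _ faF; rewrite in_setE.
exact: (gP f bf uf x a (Vgx _ faF)).
Qed.

(* Main.v *)
From HB Require Import structures.
Require Import Defs.
From mathcomp Require Import all_boot all_order all_algebra.
From mathcomp Require Import all_classical all_reals all_analysis.
From mathcomp Require Import lra.

Import Order.TTheory GRing.Theory Num.Theory.
Import numFieldNormedType.Exports.

Local Open Scope classical_set_scope.
Local Open Scope ring_scope.

(** By the ultrafilter characterization of compactness it is enough that every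
    ultrafilter [U] containing [closure A] converges.  Put
    [L G = lim_U nu G] for the ultrafilter limit; it exists since these values
    are bounded, and [L] inherits finite additivity from the measures, but not
    countable additivity.  A measure [P] with [P G <= L G] on open sets is
    recovered from [L] by regularization:
    [[
      lambda K = inf { L G | G open, K `<=` G }         for K compact,
      inner G  = sup { lambda K | K compact, K `<=` G } for G open,
      outer E  = inf { inner G | G open, E `<=` G }     for every E.
    ]]
    Compactness turns countable covers into finite ones, so [outer] is an outer
    measure; disjoint compact sets of a Hausdorff space have disjoint open
    neighbourhoods, so [lambda] is additive on them and this makes open sets
    Caratheodory measurable.  Hence [outer] is a Borel measure
    ([content_probability]).  Tightness enters only to show that no mass is lost:
    [lambda K >= 1 - eps] for the compact sets of the hypothesis, so that the
    total mass is [1].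

    The inequality [P G <= lim_U nu G] for open [G] gives
    [lim_U nu F <= P F] for closed [F], and an upper semicontinuous function is
    uniformly approximated by finite combinations of indicators of its closed
    level sets; therefore [U] converges to [P] in the A-topology
    ([portmanteau_closed]).  Finally, tightness of [A] passes to [closure A],
    because [mu K < 1 - eps] is an open condition on [mu] when [K] is closed
    ([closure_tight]). *)

(** * Separation of compact sets *)

Section hausdorff.
Set Implicit Arguments.
Unset Strict Implicit.
Variable T : ptopologicalType.

(** A point of [K] is separated from one member of the filter [N]; shrinking that
    member as the point ranges over [K] separates all of [K] from a single one.
    Used with [N] the neighbourhoods of a point, then of a compact set. *)
Lemma compact_near_closure (K : set T) (N : set_system T) :
  ProperFilter N -> compact K ->
  (forall x, K x -> exists2 V, nbhs x V & exists2 U, N U & V `&` U = set0) ->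
  exists2 U, N U & K `&` closure U = set0.
Proof.
move=> FN /compact_near_coveringP cK sepK.
pose F := powerset_filter_from N.
have [W [WN Wmono [U WU]] WK] :
    \forall U \near F, forall x, K x -> (~` closure U) x.
  apply: (cK _ F (fun U x => (~` closure U) x)) => x /sepK[V xV [U NU VU0]].
  near=> y U' => yU'.
  have /yU'[z [U'z Vz]] : nbhs y V by near: y; exact: nbhs_interior.
  by have : (V `&` U) z; [split => //; exact: (near (small_set_sub NU) U')|rewrite VU0].
exists U; first exact: WN.
by rewrite -subset0 => x [Kx]; exact: WK.
Unshelve. all: by end_near. Qed.

Hypothesis hausT : hausdorff_space T.

Lemma compact_separated (A B : set T) : compact A -> compact B ->
  A `&` B = set0 ->
  exists U V, [/\ open U, open V, A `<=` U, B `<=` V & U `&` V = set0].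
Proof.
move=> cA cB AB0.
have [->|A0] := eqVneq A set0.
  exists set0, setT; split; rewrite ?set0I//; [exact: open0|exact: openT].
have PA : ProperFilter (set_nbhs A) by apply: set_nbhs_pfilter; exact/set0P.
have [U AU BU0] : exists2 U, set_nbhs A U & B `&` closure U = set0.
  apply: compact_near_closure => // b Bb.
  have [V bV AV0] : exists2 V, nbhs b V & A `&` closure V = set0.
    apply: compact_near_closure => // a Aa.
    have ab : a != b.
      by apply/eqP => ab; have : (A `&` B) a; [split => //; rewrite ab|rewrite AB0].
    move: (hausT); rewrite open_hausdorff => /(_ a b ab)[[U V] /=].
    move=> [/set_mem aU /set_mem bV] [oU oV /eqP UV0]; exists U; first exact: open_nbhs_nbhs.
    by exists V => //; exact: open_nbhs_nbhs.
  exists V => //; exists (~` closure V).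
    apply/set_nbhsP; exists (~` closure V); split => //.
      exact/closed_openC/closed_closure.
    by move=> a Aa Va; have : (A `&` closure V) a by []; rewrite AV0.
  by rewrite -subset0 => x [Vx]; apply; exact: subset_closure.
move/set_nbhsP : AU => [W [oW AW WU]].
exists W, (~` closure U); split => //.
- exact/closed_openC/closed_closure.
- by move=> b Bb Ub; have : (B `&` closure U) b by []; rewrite BU0.
- by rewrite -subset0 => x [/WU Ux]; apply; exact: subset_closure.
Qed.

Lemma compactD (K U : set T) : compact K -> open U -> compact (K `\` U).
Proof. by move=> cK oU; apply: compact_closedI => //; exact: open_closedC. Qed.

(** The disjoint compact sets [K `\` U] and [K `\` V] have disjoint open
    neighbourhoods; [K1] and [K2] are what remains of [K] outside these. *)
Lemma compact_split (K U V : set T) : compact K -> open U -> open V ->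
  K `<=` U `|` V ->
  exists K1 K2, [/\ compact K1, compact K2, K1 `<=` U, K2 `<=` V &
    K `<=` K1 `|` K2].
Proof.
move=> cK oU oV KUV.
have [|||W1 [W2 [oW1 oW2 KW1 KW2 W0]]] := @compact_separated (K `\` U) (K `\` V).
- exact: compactD.
- exact: compactD.
- by rewrite -subset0 => x [[Kx nU] [_ nV]]; case: (KUV _ Kx).
exists (K `\` W1), (K `\` W2); split; [exact: compactD|exact: compactD|..].
- by move=> x [Kx]; apply: contra_notP => Ux; exact: KW1.
- by move=> x [Kx]; apply: contra_notP => Ux; exact: KW2.
- move=> x Kx; have [xW1|] := pselect (W1 x); last by left.
  right; split=> // xW2; have : (W1 `&` W2) x by [].
  by rewrite W0.
Qed.

End hausdorff.

(** * Approximation by open and by compact sets *)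

Section inner_outer.
Set Implicit Arguments.
Unset Strict Implicit.
Variables (T : ptopologicalType) (R : realType).
Implicit Types (f : set T -> \bar R) (E G K : set T) (c : \bar R).
Local Open Scope ereal_scope.

Definition outer_approx f E : \bar R :=
  ereal_inf [set f G | G in [set G | open G /\ E `<=` G]].

Definition inner_approx f E : \bar R :=
  ereal_sup [set f K | K in [set K | compact K /\ K `<=` E]].

Lemma outer_approx_le f E G : open G -> E `<=` G -> outer_approx f E <= f G.
Proof. by move=> oG EG; apply: ereal_inf_lbound; exists G. Qed.

Lemma ge_outer_approx f E c :
  (forall G, open G -> E `<=` G -> c <= f G) -> c <= outer_approx f E.
Proof. by move=> cf; apply: le_ereal_inf_tmp => _ [G [oG EG] <-]; exact: cf. Qed.

Lemma inner_approx_ge f E K : compact K -> K `<=` E -> f K <= inner_approx f E.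
Proof. by move=> cK KE; apply: ereal_sup_ubound; exists K. Qed.

Lemma le_inner_approx f E c :
  (forall K, compact K -> K `<=` E -> f K <= c) -> inner_approx f E <= c.
Proof. by move=> fc; apply: ge_ereal_sup => _ [K [cK KE] <-]; exact: fc. Qed.

Lemma outer_approxS f E F : E `<=` F -> outer_approx f E <= outer_approx f F.
Proof.
move=> EF; apply: ge_outer_approx => G oG FG.
exact/outer_approx_le/(subset_trans EF).
Qed.

Lemma inner_approxS f E F : E `<=` F -> inner_approx f E <= inner_approx f F.
Proof.
move=> EF; apply: le_inner_approx => K cK KE.
exact/inner_approx_ge/(subset_trans KE).
Qed.

End inner_outer.

(** * From a finitely additive content to a measure *)

Section content.
Set Implicit Arguments.
Unset Strict Implicit.
Variables (T : ptopologicalType) (R : realType) (L : set T -> \bar R).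
Local Open Scope ereal_scope.
Hypothesis hausT : hausdorff_space T.
Hypothesis L0 : L set0 = 0.
Hypothesis LT : L setT = 1.
Hypothesis L_mono : forall G H, open G -> open H -> G `<=` H -> L G <= L H.
Hypothesis L_setU : forall G H, open G -> open H -> L (G `|` H) <= L G + L H.
Hypothesis L_disj : forall G H, open G -> open H -> G `&` H = set0 ->
  L G + L H <= L (G `|` H).

(* Regularization of [L] by open, then compact, then again open sets. *)
Let lambda := outer_approx L.
Let inner := inner_approx lambda.
Let outer := outer_approx inner.

Lemma content_ge0 G : open G -> 0 <= L G.
Proof. by move=> oG; rewrite -L0; apply: L_mono => //; exact: open0. Qed.

Lemma content_le1 G : open G -> L G <= 1.
Proof. by move=> oG; rewrite -LT; apply: L_mono => //; exact: openT. Qed.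

Lemma content_fin G : open G -> L G \is a fin_num.
Proof.
by move=> oG; rewrite ge0_fin_numE ?content_ge0// (le_lt_trans (content_le1 oG))// ltry.
Qed.

Lemma lambda_ge0 E : 0 <= lambda E.
Proof. by apply: ge_outer_approx => G oG _; exact: content_ge0. Qed.

Lemma lambda_fin E : lambda E \is a fin_num.
Proof.
rewrite ge0_fin_numE ?lambda_ge0// (@le_lt_trans _ _ (L setT))//.
  by apply: outer_approx_le => //; exact: openT.
by rewrite LT ltry.
Qed.

Lemma lambda_setU E F : lambda (E `|` F) <= lambda E + lambda F.
Proof.
rewrite -leeBlDr ?lambda_fin//; apply: ge_outer_approx => G oG EG.
rewrite leeBlDr ?lambda_fin// -leeBlDl ?content_fin//.
apply: ge_outer_approx => H oH FH; rewrite leeBlDl ?content_fin//.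
apply: le_trans (L_setU oG oH); apply: outer_approx_le; first exact: openU.
exact: setUSS.
Qed.

(** Disjoint open neighbourhoods of the two compact sets cut any neighbourhood of
    the union into disjoint pieces, on which [L] is superadditive. *)
Lemma lambda_disj K1 K2 : compact K1 -> compact K2 -> K1 `&` K2 = set0 ->
  lambda K1 + lambda K2 <= lambda (K1 `|` K2).
Proof.
move=> cK1 cK2 K0; apply: ge_outer_approx => G oG; rewrite subUset => -[K1G K2G].
have [W1 [W2 [oW1 oW2 KW1 KW2 W0]]] := compact_separated hausT cK1 cK2 K0.
have oG1 : open (G `&` W1) by exact: openI.
have oG2 : open (G `&` W2) by exact: openI.
apply: (@le_trans _ _ (L (G `&` W1) + L (G `&` W2))).
  by apply: leeD; apply: outer_approx_le => //; rewrite subsetI.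
apply: (le_trans (L_disj _ _ _)) => //; first by rewrite setIACA W0 setI0.
by apply: L_mono => //; [exact: openU|rewrite -setIUr; exact: subIsetl].
Qed.

Lemma inner_le_content G : open G -> inner G <= L G.
Proof. by move=> oG; apply: le_inner_approx => K cK KG; exact: outer_approx_le. Qed.

Lemma inner_ge0 G : 0 <= inner G.
Proof.
by rewrite (le_trans (lambda_ge0 set0))//; apply: inner_approx_ge => //; exact: compact0.
Qed.

Lemma lambda_le_sum (G : (set T)^nat) n K : (forall i, open (G i)) -> compact K ->
  K `<=` \big[setU/set0]_(i < n) G i -> lambda K <= \sum_(i < n) inner (G i).
Proof.
move=> oG; elim: n K => [|n IHn] K cK; first rewrite !big_ord0 => K0.
  by rewrite -L0; apply: outer_approx_le => //; exact: open0.
rewrite !big_ord_recr/= => KG.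
have [|K1 [K2 [cK1 cK2 K1G K2G KK]]] := compact_split hausT cK _ (oG n) KG.
  by rewrite -bigcup_mkord; exact: bigcup_open.
apply: (le_trans (outer_approxS _ KK)); apply: (le_trans (lambda_setU _ _)).
by apply: leeD; [exact: IHn|exact: inner_approx_ge].
Qed.

(** Countable subadditivity, although [L] itself is only finitely subadditive: a
    compact subset of the union is already covered by finitely many terms. *)
Lemma inner_bigcup (G : (set T)^nat) : (forall i, open (G i)) ->
  inner (\bigcup_i G i) <= \sum_(i <oo) inner (G i).
Proof.
move=> oG; apply: le_inner_approx => K cK KG.
have : cover_compact K by rewrite -compact_cover.
move=> /(_ nat setT G (fun i _ => oG i) KG)[D _ KD].
pose n := (\max_(i <- finmap.enum_fset D) i).+1.
have KG' : K `<=` \big[setU/set0]_(i < n) G i.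
  move=> x /KD[i /= iD Gix]; rewrite -bigcup_mkord; exists i => //=.
  by rewrite /n ltnS; exact: (@leq_bigmax_seq _ _ xpredT id).
apply: (le_trans (lambda_le_sum oG cK KG')); rewrite -(big_mkord xpredT (inner \o G)).
by apply: nneseries_lim_ge => i _ _; exact: inner_ge0.
Qed.

Lemma outer_ge0 E : 0 <= outer E.
Proof. by apply: ge_outer_approx => G _ _; exact: inner_ge0. Qed.

Lemma outer_le1 E : outer E <= 1.
Proof.
rewrite -LT; apply: le_trans (inner_le_content openT).
by apply: outer_approx_le => //; exact: openT.
Qed.

Lemma outer_fin E : outer E \is a fin_num.
Proof.
rewrite ge0_fin_numE ?outer_ge0// (@le_lt_trans _ _ 1) ?ltry//; exact: outer_le1.
Qed.

Lemma outer_set0 : outer set0 = 0.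
Proof.
apply/eqP; rewrite eq_le outer_ge0 andbT -L0.
by apply: (@le_trans _ _ (inner set0)); [apply: outer_approx_le|apply: inner_le_content];
  rewrite //; exact: open0.
Qed.

Lemma outer_sigma_subadditive : sigma_subadditive outer.
Proof.
move=> F; apply/lee_addgt0Pr => e e0.
apply: le_trans (epsilon_trick xpredT (fun i => outer_ge0 (F i)) (ltW e0)).
have eps i : exists G, [/\ open G, F i `<=` G &
    inner G <= outer (F i) + (e / (2 ^ i.+1)%:R)%:E].
  have e'0 : (0 < e / (2 ^ i.+1)%:R :> R)%R by rewrite divr_gt0// ltr0n expn_gt0.
  have [_ [G [oG FG] <-] hG] := lb_ereal_inf_adherent e'0 (outer_fin (F i)).
  by exists G; split => //; exact: ltW.
have [G /all_and3[oG FG hG]] := choice eps.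
apply: (@le_trans _ _ (inner (\bigcup_i G i))).
  apply: outer_approx_le; first exact: bigcup_open.
  by apply: subset_bigcup => i _; exact: FG.
apply: (le_trans (inner_bigcup oG)); apply: lee_nneseries => // i _ _; exact: inner_ge0.
Qed.

Definition content_outer_measure : {outer_measure set T -> \bar R} :=
  HB.pack outer (isOuterMeasure.Build R T outer outer_set0 outer_ge0
    (@outer_approxS _ _ inner) outer_sigma_subadditive).

(** It suffices to test on open [H].  Fill [H `&` G] from inside by a compact [K1],
    then [H `\` K1], which is open and contains [H `\` G], by a compact [K2]:
    as these are disjoint, [lambda K1 + lambda K2 <= lambda (K1 `|` K2)], which
    is at most [inner H]. *)
Lemma open_caratheodory G : open G -> content_outer_measure.-caratheodory G.
Proof.
move=> oG; apply: le_caratheodory_measurable => X.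
apply: ge_outer_approx => H oH XH; rewrite -leeBrDr ?outer_fin//.
apply: (@le_trans _ _ (inner (H `&` G))).
  by apply: outer_approx_le; [exact: openI|exact: setSI].
apply: le_inner_approx => K1 cK1; rewrite subsetI => -[K1H K1G].
rewrite leeBrDr ?outer_fin//.
apply: (@le_trans _ _ (lambda K1 + inner (H `&` ~` K1))).
  apply: leeD2l; apply: outer_approx_le; last by apply: setISS => //; exact: subsetC.
  by apply: openI => //; exact/closed_openC/(compact_closed hausT).
rewrite -leeBrDl ?lambda_fin//; apply: le_inner_approx => K2 cK2.
rewrite subsetI => -[K2H K21]; rewrite leeBrDl ?lambda_fin//.
apply: (le_trans (lambda_disj cK1 cK2 _)); first by rewrite setIC; exact/disjoints_subset.
by apply: inner_approx_ge; [exact: compactU|rewrite subUset].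
Qed.

Lemma borel_caratheodory (A : set (borel T)) : measurable A ->
  content_outer_measure.-caratheodory A.
Proof.
move: A; apply: smallest_sub; last by move=> A; exact: open_caratheodory.
exact: (sigma_algebra_measurable (caratheodory_type content_outer_measure)).
Qed.

Lemma content_semi_sigma_additive :
  semi_sigma_additive (outer : set (borel T) -> \bar R).
Proof.
move=> F mF tF mUF; apply: (caratheodory_measure_sigma_additive
  (mu := content_outer_measure)) => //.
- by move=> i; exact: borel_caratheodory (mF i).
- exact: borel_caratheodory mUF.
Qed.

(** The total mass [outer setT] is at most [L setT]; the compact sets that carry
    [L] up to [e] show that nothing is lost. *)
Lemma content_probability :
  (forall e : R, (0 < e)%R -> exists2 K, compact K &
    forall G, open G -> K `<=` G -> (1 - e)%:E <= L G) ->
  exists P : probability (borel T) R, forall G, open G -> P G <= L G.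
Proof.
move=> tight.
have outer_setT : outer setT = 1.
  apply/eqP; rewrite eq_le outer_le1/=.
  apply: ge_outer_approx => G oG TG; apply/lee_addgt0Pr => e e0.
  have [K cK KL] := tight e e0.
  rewrite -leeBlDr//; apply: (@le_trans _ _ (lambda K)); first exact: ge_outer_approx.
  by apply: inner_approx_ge => //; exact: subset_trans TG.
pose m : {measure set (borel T) -> \bar R} := HB.pack outer
  (isMeasure.Build _ (borel T) R outer outer_set0 outer_ge0 content_semi_sigma_additive).
pose P : probability (borel T) R := HB.pack (Measure.sort m) (Measure.class m)
  (Measure_isProbability.Build _ (borel T) R m outer_setT).
exists P => G oG; apply: (@le_trans _ _ (inner G)); last exact: inner_le_content.
exact: outer_approx_le.
Qed.

End content.

(** * Integrals of upper semicontinuous functions *)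

Section layer_cake.
Set Implicit Arguments.
Unset Strict Implicit.
Variables (T : ptopologicalType) (R : realType).
Implicit Types (f : T -> R) (nu : probability (borel T) R).

Lemma open_measurable_borel (G : set T) : open G -> measurable (G : set (borel T)).
Proof. by move=> oG; exact: sub_sigma_algebra. Qed.

Lemma closed_measurable_borel (F : set T) :
  closed F -> measurable (F : set (borel T)).
Proof.
move=> cF; rewrite -(setCK F); apply: measurableC.
by apply: open_measurable_borel; exact: closed_openC.
Qed.

Lemma usc_open f a : upper_semicontinuous f -> open [set x | f x < a].
Proof. by move=> uf; rewrite openE => x fxa; exact: uf. Qed.

Lemma usc_closed f a : upper_semicontinuous f -> closed [set x | a <= f x].
Proof.
move=> uf; rewrite (_ : mkset _ = ~` [set x | f x < a]).
  exact/open_closedC/usc_open.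
by apply/seteqP; split => x /=; rewrite leNgt => /negP.
Qed.

Lemma usc_indic (K : set T) : closed K -> upper_semicontinuous (\1_K : T -> R).
Proof.
move=> cK x a; have [Kx|nKx] := pselect (K x).
  rewrite indicE mem_set// => a1; apply: nearW => y.
  by rewrite indicE (le_lt_trans _ a1)//; case: (_ \in _).
rewrite indicE memNset// => a0.
have : nbhs x (~` K) by apply: open_nbhs_nbhs; split => //; exact: closed_openC.
by apply: filterS => y Ky; rewrite indicE memNset.
Qed.

Lemma usc_integrable f nu : bounded_fun f -> upper_semicontinuous f ->
  nu.-integrable [set: borel T] (EFin \o f).
Proof.
move=> bf uf; apply: measurable_bounded_integrable => //.
  by rewrite (le_lt_trans (probability_le1 nu measurableT))// ltry.
move=> mT.
apply: (measurability _ (measurable_realfun.RGenInftyO.measurableE R)) => //.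
move=> _ [_ [a ->] <-]; rewrite setTI; apply: open_measurable_borel.
rewrite (_ : _ @^-1` _ = [set x | f x < a]); first exact: usc_open.
by apply/seteqP; split => x /=; rewrite in_itv.
Qed.

(** The number of multiples of [d] in the interval from [0] to [y] is the integer
    part of [y / d] plus one, so [d] times this number exceeds [y] by at most [d];
    the bound on [y] ensures that the first [n] multiples suffice. *)
Lemma staircase_le (y d : R) n : 0 < d -> 0 <= y -> y <= n%:R * d ->
  y <= \sum_(k < n) d * (k%:R * d <= y)%R%:R <= y + d.
Proof.
move=> d0 y0 ynd; set S := fun n => \sum_(k < n) d * (k%:R * d <= y)%R%:R.
(* The induction drops the bound on [y]: as long as the multiples of [d] stay
   below [y], the staircase has its maximal value [n%:R * d]. *)
have [_ Syd Sy] : [/\ S n <= n%:R * d, S n <= y + d & y <= S n \/ n%:R * d <= S n].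
  elim: (n) => [|m [IH1 IH2 IH3]]; rewrite /S ?big_ord0 ?big_ord_recr/= -/(S _).
    by split; [rewrite mul0r|rewrite addr_ge0// ltW|right; rewrite mul0r].
  rewrite -/(S m) -natr1 mulrDl mul1r.
  have [my|my] := lerP (m%:R * d) y; rewrite ?mulr1 ?mulr0.
    by split; [lra|lra|case: IH3 => ?; [left|right]; lra].
  by split; [lra|lra|left; case: IH3; lra].
by rewrite Syd andbT; case: Sy => //; exact: le_trans.
Qed.

Lemma integral_of_indic (A : set (borel T)) (nu : borel_probability T R) :
  measurable A -> integral_of \1_A nu = fine (nu A).
Proof. by move=> mA; rewrite /integral_of /Rintegral integral_indic// setIT. Qed.

(** The integral of the staircase approximation of [f - c]: a Riemann sum for the
    layer cake formula.  For an upper semicontinuous [f] it depends on [nu] only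
    through the measures of closed sets. *)
Definition level_sum f (c d : R) (n : nat) nu : R :=
  \sum_(k < n) d * fine (nu [set x | c + k%:R * d <= f x]).

Lemma level_sum_bounds f (c d : R) (n : nat) nu :
  bounded_fun f -> upper_semicontinuous f -> 0 < d ->
  (forall x, c <= f x <= c + n%:R * d) ->
  \int[nu]_x f x - c <= level_sum f c d n nu <= \int[nu]_x f x - c + d.
Proof.
move=> bf uf d0 fc.
pose F k : set (borel T) := [set x | c + k%:R * d <= f x].
have mF k : measurable (F k) by apply: closed_measurable_borel; exact: usc_closed.
pose s x : R := \sum_(k < n) d * \1_(F k) x.
have sE x : s x = \sum_(k < n) d * (k%:R * d <= f x - c)%R%:R.
  apply: eq_bigr => k _; rewrite indicE; congr (_ * (nat_of_bool _)%:R).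
  by rewrite lerBrDl; apply/idP/idP => [/set_mem|?] //; exact/mem_set.
pose g k x : \bar R := (d%:E * (\1_(F k) x)%:E)%E.
have ig k : nu.-integrable setT (g k).
  by apply: integrableZl => //; exact: integrable_indic.
have sg : EFin \o s = fun x => (\sum_(k < n) g k x)%E.
  by apply/funext => x; rewrite /= -sumEFin.
have is_ : nu.-integrable setT (EFin \o s) by rewrite sg; exact: integrable_sum.
have <- : \int[nu]_x s x = level_sum f c d n nu.
  rewrite /Rintegral (_ : (fun x => (s x)%:E) = EFin \o s)// sg.
  rewrite integral_sum// (eq_bigr (fun k : 'I_n => (d * fine (nu (F k)))%:E)).
    by rewrite sumEFin.
  move=> k _; rewrite integralZl//; last exact: integrable_indic.
  by rewrite integral_indic// setIT EFinM fineK// fin_num_measure.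
have intf := usc_integrable nu bf uf.
have intc r : nu.-integrable [set: borel T] (EFin \o cst r).
  by apply: finite_measure_integrable_cst.
have cstE r : \int[nu]_x (cst r x) = r.
  rewrite Rintegral_cst// -[RHS]mulr1; congr (_ * _).
  exact: (congr1 fine (probability_setT nu)).
have fE r : \int[nu]_x f x - r = \int[nu]_x (f x - cst r x).
  by rewrite RintegralB// cstE.
have intfc r : nu.-integrable [set: borel T] (EFin \o (fun x => f x - cst r x)).
  by rewrite (_ : _ \o _ = (EFin \o f) \- (EFin \o cst r))%E//; exact: integrableB.
have stair x : f x - c <= s x <= f x - c + d.
  rewrite sE; have /andP[cf fn] := fc x.
  by apply: staircase_le => //; rewrite ?subr_ge0// lerBlDl.
rewrite (_ : _ - c + d = \int[nu]_x f x - (c - d)); last lra.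
rewrite !fE; apply/andP; split; apply: le_Rintegral => // x _.
  by have /andP[] := stair x.
by have /andP[_] := stair x; rewrite /cst/=; lra.
Qed.

End layer_cake.

(** * Convergence in the A-topology *)

Section portmanteau.
Set Implicit Arguments.
Unset Strict Implicit.
Variables (T : ptopologicalType) (R : realType).

Lemma A_topology_cvg (U : set_system (borel_probability T R))
    (P : borel_probability T R) : Filter U ->
  (forall f : T -> R, bounded_fun f -> upper_semicontinuous f ->
    forall a, integral_of f P < a -> \forall nu \near U, integral_of f nu < a) ->
  U --> P.
Proof.
move=> FU UP W [_ [[B DB <-] [V BV VP] BW]].
have [F sF VE] := DB _ BV.
suff : U V by apply: filterS => nu Vnu; apply: BW; exists V.
rewrite -VE in VP *.
apply: filter_bigI => -[f a] faF.
have [bf uf] : bounded_fun f /\ upper_semicontinuous f.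
  by have := sF _ faF; rewrite in_setE.
exact: UP (VP _ faF).
Qed.

(** Up to the constant [c], the integral of [f] is within [d] of a level sum, which
    involves finitely many closed sets. *)
Lemma portmanteau_closed (U : set_system (borel_probability T R))
    (P : borel_probability T R) : Filter U ->
  (forall F : set T, closed F -> forall e : R, 0 < e ->
    U [set nu : borel_probability T R | fine (nu F) < fine (P F) + e]) ->
  U --> P.
Proof.
move=> FU UP; apply: A_topology_cvg => f bf uf a Pfa.
have [M [_ Mf]] := bf; pose c := - (M + 1).
(* Two of the three parts of the gap are spent: one on the level sum of [P], one
   on the change of the level sum from [P] to [nu]. *)
pose d := (a - integral_of f P) / 3.
have d0 : 0 < d by rewrite divr_gt0// subr_gt0.
have [n nd] : exists n : nat, 2 * (`|M| + 1) <= n%:R * d.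
  exists (Num.bound (2 * (`|M| + 1) / d)); rewrite -ler_pdivrMr// ltW//.
  apply: archi_boundP; apply: divr_ge0; last exact: ltW.
  by rewrite mulr_ge0// addr_ge0.
have fc x : c <= f x <= c + n%:R * d.
  have /= := Mf (M + 1); rewrite ltrDl ltr01 => /(_ isT x I).
  rewrite ler_norml => /andP[fM Mfx]; rewrite fM/=.
  by apply: (le_trans Mfx); rewrite /c; have := ler_norm M; lra.
(* The [n] terms of the level sum change by less than [d * e] each. *)
pose e : R := n.+1%:R^-1.
have e0 : 0 < e by rewrite invr_gt0 ltr0n.
have : U [set nu : borel_probability T R | forall k : 'I_n,
    fine (nu [set x | c + k%:R * d <= f x]) <
    fine (P [set x | c + k%:R * d <= f x]) + e].
  by apply: filter_forall => k; apply: UP => //; exact: usc_closed.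
apply: filterS => nu nuP.
have /andP[nuS _] := level_sum_bounds nu bf uf d0 fc.
have /andP[_ PS] := level_sum_bounds P bf uf d0 fc.
have SS : level_sum f c d n nu <= level_sum f c d n P + d.
  apply: (@le_trans _ _ (level_sum f c d n P + \sum_(k < n) d * e)).
    rewrite -big_split/=; apply: ler_sum => k _; rewrite -mulrDr.
    by rewrite ler_pM2l// ltW.
  rewrite lerD2l sumr_const card_ord -mulr_natr -mulrA ler_piMr ?ltW//.
  by rewrite /e mulrC ltr_pdivrMr ?ltr0n// mul1r ltr_nat.
have aE : a = integral_of f P + 3 * d by rewrite /d mulrC divfK ?pnatr_eq0//; lra.
by rewrite -/(integral_of f nu) -/(integral_of f P) in nuS PS; lra.
Qed.

End portmanteau.

(** * Limits along an ultrafilter of measures *)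

Section ultrafilter.
Set Implicit Arguments.
Unset Strict Implicit.

Lemma ultra_bounded_cvg (X : Type) (U : set_system X) (R : realType)
    (g : X -> R) (a b : R) : UltraFilter U ->
  (forall x, a <= g x <= b) -> cvg (g @ U).
Proof.
move=> UU gab.
have [|p [_ clp]] := @segment_compact R a b (g @ U) _.
  by apply: (@filterE X U) => x; rewrite /= in_itv /= gab.
apply/cvg_ex; exists p => B pB.
have [//|UB] := in_ultra_setVsetC (g @^-1` B) UU.
by have [y []] := clp (~` B) B UB pB.
Qed.

Variables (T : ptopologicalType) (R : realType).
Variables (U : set_system (borel_probability T R)).
Hypothesis UU : UltraFilter U.

Definition ultralim (E : set T) : R :=
  lim ((fun nu : borel_probability T R => fine (nu E)) @ U).

Lemma prob_fine (nu : borel_probability T R) (E : set (borel T)) :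
  measurable E -> (fine (nu E))%:E = nu E.
Proof. by move=> mE; rewrite fineK// fin_num_measure. Qed.

Lemma ultralim_cvg (E : set (borel T)) : measurable E ->
  (fun nu : borel_probability T R => fine (nu E)) @ U --> ultralim E.
Proof.
move=> mE; apply: (@ultra_bounded_cvg _ _ _ _ 0 1) => nu.
by rewrite -!lee_fin prob_fine// measure_ge0 probability_le1.
Qed.

Lemma ultralim_ge c (E : set (borel T)) : measurable E ->
  U [set nu : borel_probability T R | (c%:E <= nu E)%E] -> c <= ultralim E.
Proof.
move=> mE cE; apply: limr_ge; first exact: (ultralim_cvg mE).
by apply: filterS cE => nu; rewrite -lee_fin prob_fine.
Qed.

Lemma ultralim_set0 : ultralim set0 = 0.
Proof.
rewrite /ultralim (_ : (fun nu => _) = cst 0); first exact: lim_cst.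
by apply/funext => nu; rewrite measure0.
Qed.

Lemma ultralim_setT : ultralim setT = 1.
Proof.
rewrite /ultralim (_ : (fun nu => _) = cst 1); first exact: lim_cst.
by apply/funext => nu; exact: (congr1 fine (probability_setT nu)).
Qed.

Lemma le_ultralim (E F : set (borel T)) : measurable E -> measurable F ->
  E `<=` F -> ultralim E <= ultralim F.
Proof.
move=> mE mF EF; apply: ler_lim; [exact: (ultralim_cvg mE)|exact: (ultralim_cvg mF)|].
by apply: nearW => nu; rewrite -lee_fin !prob_fine// le_measure ?inE.
Qed.

Lemma ultralimD (E F : set (borel T)) : measurable E -> measurable F ->
  (fun nu : borel_probability T R => fine (nu E) + fine (nu F)) @ U -->
  ultralim E + ultralim F.
Proof. by move=> mE mF; apply: cvgD; exact: ultralim_cvg. Qed.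

Lemma ultralim_setU (E F : set (borel T)) : measurable E -> measurable F ->
  ultralim (E `|` F) <= ultralim E + ultralim F.
Proof.
move=> mE mF; have cEF := ultralimD mE mF.
rewrite -(cvg_lim (@Rhausdorff R) cEF); apply: ler_lim.
- exact: (ultralim_cvg (measurableU _ _ mE mF)).
- by apply/cvg_ex; exists (ultralim E + ultralim F).
- apply: nearW => nu; rewrite -lee_fin EFinD !prob_fine//; last exact: measurableU.
  exact: measureU2.
Qed.

Lemma ultralim_disjoint (E F : set (borel T)) : measurable E -> measurable F ->
  E `&` F = set0 -> ultralim (E `|` F) = ultralim E + ultralim F.
Proof.
move=> mE mF EF; have cEF := ultralimD mE mF.
rewrite -(cvg_lim (@Rhausdorff R) cEF); congr (lim (_ @ U)).
apply/funext => nu; apply: EFin_inj; rewrite EFinD !prob_fine//.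
  exact: measureU.
exact: measurableU.
Qed.

(** The ultrafilter limits form a content on open sets; the measure it
    regularizes to is a limit of [U], by the portmanteau criterion applied to
    complements. *)
Lemma tight_ultrafilter_cvg : hausdorff_space T ->
  (forall e : R, 0 < e -> exists2 K : set T, compact K &
    U [set nu : borel_probability T R | ((1 - e)%:E <= nu K)%E]) ->
  exists P : borel_probability T R, U --> P.
Proof.
move=> hausT tight.
have mO := @open_measurable_borel T.
have [||||||P PL] := @content_probability T R (fun G => (ultralim G)%:E) hausT.
- by rewrite ultralim_set0.
- by rewrite ultralim_setT.
- by move=> G H /mO mG /mO mH GH; rewrite lee_fin le_ultralim.
- by move=> G H /mO mG /mO mH; rewrite -EFinD lee_fin ultralim_setU.
- by move=> G H /mO mG /mO mH GH; rewrite -EFinD lee_fin ultralim_disjoint.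
- move=> e /tight[K cK UK]; exists K => // G oG KG; rewrite lee_fin.
  apply: ultralim_ge; first exact: mO.
  apply: filterS UK => nu /le_trans; apply; apply: le_measure; rewrite ?inE//.
    by apply: closed_measurable_borel; exact: compact_closed.
  exact: mO.
exists P; apply: portmanteau_closed => F cF e e0.
have oF : open (~` F) by exact: closed_openC.
have mF : measurable (F : set (borel T)) by exact: closed_measurable_borel.
have fineC (nu : borel_probability T R) : fine (nu (~` F)) = 1 - fine (nu F).
  by apply: EFin_inj; rewrite EFinB !prob_fine ?probability_setC//; exact: mO.
have := PL _ oF; rewrite -(prob_fine P (mO _ oF)) lee_fin fineC => PF.
have lt : 1 - fine (P F) - e < ultralim (~` F) by lra.
have /cvgr_gt/(_ _ lt) := ultralim_cvg (mO _ oF).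
by apply: filterS => nu; rewrite fineC /=; lra.
Qed.

End ultrafilter.

(** The integral of the indicator of a closed set is an upper semicontinuous
    function of the measure, so [mu K >= c] is a closed condition. *)
Lemma closure_tight (T : ptopologicalType) (R : realType)
    (A : set (borel_probability T R)) (K : set T) (c : R) :
  closed K -> (forall mu : borel_probability T R, A mu -> (c%:E <= mu K)%E) ->
  forall mu : borel_probability T R, closure A mu -> (c%:E <= mu K)%E.
Proof.
move=> cK Ac mu clA; rewrite leNgt; apply/negP.
have mK := closed_measurable_borel cK.
rewrite -(prob_fine mu mK) lte_fin -(integral_of_indic mu mK) => muc.
have bK : bounded_fun (\1_K : T -> R).
  exists 1; split => // x x1 y _; rewrite /= indicE (le_trans _ (ltW x1))//.
  by case: (_ \in _); rewrite ?normr1 ?normr0.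
have [nu [/Ac + /=]] := clA _ (integral_of_usc bK (usc_indic cK) muc).
by rewrite -(prob_fine nu mK) lee_fin integral_of_indic// leNgt => /negbTE ->.
Qed.

(** * Prokhorov's theorem *)

Theorem theoremB27 (R : realType) (T : ptopologicalType)
    (A : set (borel_probability T R))
    (hausT : hausdorff_space T)
    (tightA : forall eps : R, 0 < eps ->
       exists2 K : set T, compact K &
         forall mu : borel_probability T R, A mu -> ((1 - eps)%:E <= mu K)%E) :
  compact (closure A).
Proof.
rewrite compact_ultra => U UU UA.
have [e /tightA[K cK AK]|P UP] := tight_ultrafilter_cvg UU hausT.
  exists K => //; apply: filterS UA => nu.
  exact: closure_tight (compact_closed hausT cK) AK _.
exists P; split => //; apply: closed_closure => B /UP UB.
by have [nu] := filter_ex (filterI UA UB); exists nu.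
Qed.
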